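(* There exists a universal constant $L>1$ with the following properties. (1) If $\ell\subset\mathbb{R}^3$ is a (straight) line, then $\mathrm{Lip}((\ell,d_K),\mathbb{R}^3)\le L$. (2) If $P\subset\mathbb{R}^3$ is a (affine) plane, then $\mathrm{Lip}((P,d_K),\mathbb{R}^4)\le L$.
   Context: The Heisenberg group $\mathbb{H}$ is $\mathbb{R}^3$ with group law $(x,y,z)\cdot(x',y',z')=(x+x',y+y',z+z'+\tfrac12(xy'-x'y))$. The Korányi metric is $d_K(p,q)=\big(((x-x')^2+(y-y')^2)^2+16(z-z'+\tfrac12(xy'-x'y))^2\big)^{1/4}$ for $p=(x,y,z)$, $q=(x',y',z')$. A map $f:(X,d_X)\to(Y,d_Y)$ is $L$-bi-Lipschitz ($L\ge1$) if $L^{-1}d_X(a,b)\le d_Y(f(a),f(b))\le L d_X(a,b)$ for all $a,b\in X$, and $\mathrm{Lip}(X,Y)$ denotes the infimum of all $L$ for which an $L$-bi-Lipschitz map $X\to Y$ exists ($\infty$ if none). Euclidean spaces carry the Euclidean metric. *)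

(* Defs.v *)
From HB Require Import structures.
From mathcomp Require Import all_boot all_order all_algebra.
From mathcomp Require Import all_classical all_reals ereal.
From mathcomp Require Import Rstruct.
Set Implicit Arguments. Unset Strict Implicit. Unset Printing Implicit Defensive.
Import Order.TTheory GRing.Theory Num.Theory.
Local Open Scope ring_scope.
Local Open Scope classical_set_scope.

Notation RR := Rdefinitions.R.

Definition c0 : 'I_3 := @Ordinal 3 0 isT.
Definition c1 : 'I_3 := @Ordinal 3 1 isT.
Definition c2 : 'I_3 := @Ordinal 3 2 isT.
Definition hx (p : 'rV[RR]_3) : RR := p ord0 c0.
Definition hy (p : 'rV[RR]_3) : RR := p ord0 c1.
Definition hz (p : 'rV[RR]_3) : RR := p ord0 c2.

Definition deucl (n : nat) (p q : 'rV[RR]_n) : RR :=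
  Num.sqrt (\sum_(i < n) (p ord0 i - q ord0 i) ^+ 2).

(* Koranyi metric on the Heisenberg group (R^3 with the given group law) *)
Definition dK (p q : 'rV[RR]_3) : RR :=
  Num.sqrt (Num.sqrt
    (((hx p - hx q) ^+ 2 + (hy p - hy q) ^+ 2) ^+ 2
     + 16 * (hz p - hz q + (hx p * hy q - hx q * hy p) / 2) ^+ 2)).

Definition biLipOn (T U : Type) (X : set T) (dX : T -> T -> RR) (dY : U -> U -> RR)
  (L : RR) (f : T -> U) : Prop :=
  forall a b, X a -> X b ->
    L^-1 * dX a b <= dY (f a) (f b) /\ dY (f a) (f b) <= L * dX a b.

(* Lip((X,dX),(U,dY)) as an extended real: infimum of admissible L >= 1,
   +oo when no bi-Lipschitz map exists *)
Definition LipConst (T U : Type) (X : set T) (dX : T -> T -> RR) (dY : U -> U -> RR)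
  : \bar RR :=
  ereal_inf [set (L%:E)%E | L in [set L : RR | 1 <= L /\ exists f : T -> U, biLipOn X dX dY L f]].

Definition is_line (l : set 'rV[RR]_3) : Prop :=
  exists (p v : 'rV[RR]_3), v != 0 /\ l = [set p + t *: v | t in [set: RR]].

Definition is_plane (P : set 'rV[RR]_3) : Prop :=
  exists (p u w : 'rV[RR]_3),
    (forall s t : RR, s *: u + t *: w = 0 -> s = 0 /\ t = 0) /\
    P = [set p + (st.1 *: u + st.2 *: w) | st in [set: RR * RR]].

(* Main.v *)
Require Import Defs.
From HB Require Import structures.
From mathcomp Require Import all_boot all_order all_algebra.
From mathcomp Require Import all_classical all_reals ereal.
From mathcomp Require Import Rstruct.
From mathcomp Require Import topology normedtype.
From mathcomp Require Import zify ring lra.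
Set Implicit Arguments. Unset Strict Implicit.
Import Order.TTheory GRing.Theory Num.Theory.
Import numFieldNormedType.Exports.
Local Open Scope ring_scope.
Local Open Scope classical_set_scope.

(** On a line, the fourth power of the Koranyi distance is
[a * tau ^ 4 + b * tau ^ 2] in the parameter difference [tau]. On a vertical
plane the distance is comparable to the product of a Euclidean line with a line
carrying [|tau| ^ (1/2)]. On any other plane, after moving the characteristic
point to the origin, it is comparable to the metric of the cone over the circle
carrying the square root of its arc length.

So the core is a curve in space with
[|f t - f s| ^ 4 ~ (t - s) ^ 4 + (t - s) ^ 2]. Start from the straight row of
unit cubes and repeatedly replace each cube of the chain by a chain of
[121 = 11 ^ 2] subcubes of side [1 / 11] which does not come back close to
itself. Blowing this curve up along an ultrafilter gives a map [f] on the line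
with [|f t - f s| ^ 2 ~ |t - s|]; composing it with stereographic projections of
the circle and of the 3-sphere and taking the cone gives the map on the
non-vertical planes. *)

(** * A pattern of 121 subcubes *)

Notation vec := (int * int * int)%type.

Definition coord (i : 'I_3) (p : vec) : int :=
  match val i with 0%N => p.1.1 | 1%N => p.1.2 | _ => p.2 end.

Definition dot (p q : vec) : int := p.1.1 * q.1.1 + p.1.2 * q.1.2 + p.2 * q.2.

(* The closed unit cubes centred at [p] and [q] are disjoint. *)
Definition far (p q : vec) : bool :=
  [|| 2 <= `|p.1.1 - q.1.1|, 2 <= `|p.1.2 - q.1.2| | 2 <= `|p.2 - q.2|].

Definition dirs : seq vec :=
  [:: (1, 0, 0); (-1, 0, 0); (0, 1, 0); (0, -1, 0); (0, 0, 1); (0, 0, -1)].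

Definition turn_ok (a b : vec) : bool := [&& a \in dirs, b \in dirs & b != - a].

Definition run n (a : vec) : seq vec := nseq n a.

Definition zigzag (b c : vec) : seq vec :=
  run 4 c ++ run 2 b ++ run 8 (- c) ++ run 2 b ++ run 8 c ++ run 2 b.

(* Walks of 120 unit steps through the cube of side 11 centred at the origin,
   from the centre of the face entered in direction [a] to the centre of the
   face left in direction [a], resp. [b]. The strands fill the cube
   back and forth at mutual distance 2; [c] is a direction normal to [a] and
   [b]. *)
Definition straight_word (a b c : vec) : seq vec :=
  run 1 a ++ run 4 (- b) ++ run 2 a
  ++ zigzag b c ++ run 8 (- c) ++ run 2 b ++ run 4 c ++ run 2 a
  ++ zigzag (- b) c ++ run 8 (- c) ++ run 2 (- b) ++ run 4 c ++ run 2 a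
  ++ run 4 c ++ run 2 b ++ run 4 (- c) ++ run 2 b
  ++ run 3 c ++ run 2 b ++ run 3 (- c) ++ run 2 b
  ++ run 2 a ++ run 4 (- b) ++ run 1 a.

Definition turn_word (a b c : vec) : seq vec :=
  run 1 a ++ run 4 (- b) ++ run 2 a ++ run 1 c ++ run 2 a ++ run 1 (- c)
  ++ run 4 a
  ++ zigzag b c ++ run 8 (- c) ++ run 2 b ++ run 4 c ++ run 2 (- a)
  ++ zigzag (- b) c ++ run 4 (- c) ++ run 2 (- a)
  ++ zigzag b c ++ run 4 (- c) ++ run 1 b.

(** A cyclic shift of the axes: for [a] in [dirs], the vectors [rot a] and [rot (rot a)] complete
    [a] to an orthogonal frame. *)
Definition rot (p : vec) : vec := (p.2, p.1.1, p.1.2).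

Definition cross (p q : vec) : vec :=
  (p.1.2 * q.2 - p.2 * q.1.2, p.2 * q.1.1 - p.1.1 * q.2,
   p.1.1 * q.1.2 - p.1.2 * q.1.1).

Definition word (a b : vec) : seq vec :=
  if a == b then straight_word a (rot a) (rot (rot a))
  else turn_word a b (cross a b).

Definition trail (a b : vec) : seq vec := scanl +%R (- a *+ 5) (word a b).

Definition pattern (a b : vec) : seq vec := - a *+ 5 :: trail a b.

Definition box (x y z : int) (o : vec) : bool :=
  [&& `|o.1.1| <= x, `|o.1.2| <= y & `|o.2| <= z].

(* Two steps apart is not enough: around a corner the cubes share an edge. *)
Fixpoint spread (s : seq vec) : bool :=
  if s is p :: s' then all (far p) (drop 2 s') && spread s' else true.

(** The box condition keeps subcubes off the edges of the parent. By the two [dot] conditions, only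
    the first subcube touches the entry face and only the last one the exit face. *)
Definition pattern_ok (a b : vec) : bool :=
  let w := word a b in let p := trail a b in
  [&& size w == 120, last 0 p == b *+ 5, path turn_ok a (rcons w b),
      all (fun o => [|| box 5 4 4 o, box 4 5 4 o | box 4 4 5 o])
        (- a *+ 5 :: p),
      all (fun o => - 4 <= dot a o) p,
      all (fun o => dot b o <= 4) (belast (- a *+ 5) p) &
      spread (- a *+ 5 :: p)].

(** Only 30 pairs of directions are admissible, so the geometry of the two words is settled by
    evaluation. *)
Lemma all_pattern_ok :
  all (fun a => all (fun b => turn_ok a b ==> pattern_ok a b) dirs) dirs.
Proof. by vm_compute. Qed.

Lemma patternP a b : turn_ok a b -> pattern_ok a b.
Proof.
move=> ab; case/and3P: (ab) => ina inb _.
by move/allP/(_ _ ina)/allP/(_ _ inb)/implyP: all_pattern_ok; apply.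
Qed.

Section Pattern.
Variables a b : vec.
Hypothesis ab : turn_ok a b.

Lemma size_word : size (word a b) = 120.
Proof. by case/and5P: (patternP ab) => /eqP. Qed.

Lemma size_pattern : size (pattern a b) = 121.
Proof. by rewrite /= size_scanl size_word. Qed.

Lemma patternS r : (r < 120)%N ->
  nth 0 (pattern a b) r.+1 =
  nth 0 (pattern a b) r + nth 0 (rcons (word a b) b) r.
Proof.
move=> r120; have r_w : (r < size (word a b))%N by rewrite size_word.
rewrite nth_rcons r_w !nth_cons_scanl ?(ltnW r_w) //.
by rewrite (take_nth 0 r_w) foldl_rcons.
Qed.

Lemma pattern_last : nth 0 (pattern a b) 120 = b *+ 5.
Proof.
case/and5P: (patternP ab) => _ /eqP <- _ _ _.
by rewrite (last_nth 0) size_scanl size_word.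
Qed.

Lemma pattern_turn r : (r < 121)%N ->
  turn_ok (nth 0 (a :: word a b) r) (nth 0 (rcons (word a b) b) r).
Proof.
case/and4P: (patternP ab) => _ _ /(pathP 0) + _ r_lt; move/(_ r).
rewrite size_rcons size_word => /(_ r_lt).
by rewrite -rcons_cons nth_rcons /= size_word r_lt.
Qed.

Lemma pattern_box r : (r < 121)%N -> let o := nth 0 (pattern a b) r in
  [|| box 5 4 4 o, box 4 5 4 o | box 4 4 5 o].
Proof.
case/and5P: (patternP ab) => _ _ _ /allP + _ r_lt; apply.
by rewrite mem_nth // size_pattern.
Qed.

Lemma pattern_enter r : (0 < r < 121)%N -> - 4 <= dot a (nth 0 (pattern a b) r).
Proof.
case/and5P: (patternP ab) => _ _ _ _ /andP[/allP + _].
by case: r => //= r + r_lt; apply; rewrite mem_nth // size_scanl size_word.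
Qed.

Lemma pattern_exit r : (r < 120)%N -> dot b (nth 0 (pattern a b) r) <= 4.
Proof.
case/and5P: (patternP ab) => _ _ _ _ /and3P[_ /allP + _] r_lt.
have sz : size (belast (- a *+ 5) (trail a b)) = 120.
  by rewrite size_belast size_scanl size_word.
rewrite /pattern lastI nth_rcons sz r_lt; apply.
by rewrite mem_nth // sz.
Qed.

Lemma spread_nth s r r' : spread s -> (r + 3 <= r')%N -> (r' < size s)%N ->
  far (nth 0 s r) (nth 0 s r').
Proof.
elim: s r r' => [|p s IHs] r r'; first by rewrite ltn0.
case/andP=> ps ss; case: r' => [|r']; first by rewrite addn3.
case: r => [|r] rr' r's; last first.
  by apply: IHs => //; lia.
move/allP: ps; apply; have -> : r'.+1 = (2 + (r' - 2)).+1 by lia.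
by rewrite /= -nth_drop mem_nth // size_drop; move: r's => /=; lia.
Qed.

Lemma pattern_far r r' : (r + 3 <= r')%N -> (r' < 121)%N ->
  far (nth 0 (pattern a b) r) (nth 0 (pattern a b) r').
Proof.
move=> rr' r'_lt; apply: spread_nth => //; last by rewrite size_pattern.
by case/and5P: (patternP ab) => _ _ _ _ /and3P[].
Qed.

End Pattern.

(** * The chains of cubes *)

Record cell := Cell { pos : vec; din : vec; dout : vec }.

Definition subcell (c : cell) (r : nat) : cell :=
  let a := din c in let b := dout c in
  Cell (pos c *+ 11 + nth 0 (pattern a b) r)
    (nth 0 (a :: word a b) r) (nth 0 (rcons (word a b) b) r).

(* The [j]-th cube of the [k]-th chain, scaled up by [11 ^ k]; the base 121
   digits of [j] locate it in its ancestors. *)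
Fixpoint cells (k : nat) (j : int) : cell :=
  if k is k'.+1 then subcell (cells k' (j %/ 121)%Z) `|(j %% 121)%Z|
  else Cell (j, 0, 0) (1, 0, 0) (1, 0, 0).

Lemma cellsS k j :
  cells k.+1 j = subcell (cells k (j %/ 121)%Z) `|(j %% 121)%Z|.
Proof. by []. Qed.

Lemma cells_turn k j : turn_ok (din (cells k j)) (dout (cells k j)).
Proof.
by elim: k j => [|k IHk] j //; apply: pattern_turn; [exact: IHk | lia].
Qed.

(** Within a parent this is one step of the walk. Between parents [p] and [p + b], the last and the
    first subcube sit at [p *+ 11 + b *+ 5] and [(p + b) *+ 11 - b *+ 5], which differ by [b]. *)
Lemma cells_succ k j :
  pos (cells k (j + 1)) = pos (cells k j) + dout (cells k j) /\
  din (cells k (j + 1)) = dout (cells k j).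
Proof.
elim: k j => [|k IHk] j; first by [].
rewrite !cellsS.
have := cells_turn k (j %/ 121)%Z; have [] := IHk (j %/ 121)%Z.
set i := (j %/ 121)%Z; set r := `|(j %% 121)%Z|%N.
have [r_lt|r_ge] := ltnP r 120.
  have -> : ((j + 1) %/ 121)%Z = i by rewrite /i; lia.
  have -> : `|((j + 1) %% 121)%Z|%N = r.+1 by rewrite /r in r_lt *; lia.
  case: (cells k i) => p a b /= _ _ ab.
  split; last by rewrite nth_rcons size_word // r_lt.
  rewrite [LHS]/(p *+ 11 + nth 0 (pattern a b) r.+1) patternS //.
  exact: addrA.
have -> : ((j + 1) %/ 121)%Z = i + 1 by rewrite /i /r in r_ge *; lia.
have -> : `|((j + 1) %% 121)%Z|%N = 0%N by rewrite /r in r_ge *; lia.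
have r120 : r = 120%N by rewrite /r in r_ge *; lia.
case: (cells k i) => p a b; case: (cells k (i + 1)) => p' a' b' /= -> -> ab.
rewrite r120 pattern_last // nth_rcons size_word // ltnn eqxx; split=> //.
by rewrite mulrnDl mulNrn -!(addrA (p *+ 11)) -mulrnBr // -mulrSr.
Qed.

(** Once reversals are excluded, two coordinate directions are equal or orthogonal. *)
Lemma turn_case (P : vec -> vec -> Prop) :
  (forall a, a \in dirs -> P a a) ->
  (forall a b, a \in dirs -> b \in dirs -> dot a b = 0 -> P a b) ->
  forall a b, turn_ok a b -> P a b.
Proof.
move=> Pd Pt a b /and3P[ina inb nab].
have : (a == b) || (dot a b == 0).
  move: inb nab; have /allP/(_ _ ina)/allP/(_ b) : all (fun a => all (fun b =>
    (b != - a) ==> ((a == b) || (dot a b == 0))) dirs) dirs by [].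
  by move=> /[apply] /implyP.
by case/orP=> /eqP; [move=> <-; apply: Pd | apply: Pt].
Qed.

(** * Iterated substitution *)

Lemma dirs_ind (P : vec -> Prop) :
  P (1, 0, 0) -> P (-1, 0, 0) -> P (0, 1, 0) -> P (0, -1, 0) ->
  P (0, 0, 1) -> P (0, 0, -1) -> forall a, a \in dirs -> P a.
Proof.
move=> P1 P2 P3 P4 P5 P6 a.
by rewrite !inE; do 5?[case/orP => [/eqP->//|]]; move=> /eqP->.
Qed.

Lemma dotD a p q : dot a (p + q) = dot a p + dot a q.
Proof.
case: a p q => [[a1 a2] a3] [[p1 p2] p3] [[q1 q2] q3].
by rewrite /dot /=; ring.
Qed.

Lemma dotN a p : dot a (- p) = - dot a p.
Proof. by case: a p => [[a1 a2] a3] [[p1 p2] p3]; rewrite /dot /=; ring. Qed.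

Lemma dotMn a p n : dot a (p *+ n) = dot a p *+ n.
Proof.
elim: n => [|n IHn]; last by rewrite !mulrS dotD IHn.
by rewrite !mulr0n /dot !mulr0.
Qed.

Lemma dot_dir a : a \in dirs -> dot a a = 1.
Proof. by move: a; apply: dirs_ind. Qed.

Lemma farC p q : far p q = far q p.
Proof. by rewrite /far !(distrC (q.1.1), distrC (q.1.2), distrC q.2). Qed.

Lemma far_addl p q o : far (p + q) (p + o) = far q o.
Proof.
case: p q o => [[p1 p2] p3] [[q1 q2] q3] [[o1 o2] o3].
by rewrite /far /= !opprD !(addrACA _ _ (- _)) !subrr !add0r.
Qed.

Lemma far_dot a p q : a \in dirs -> 2 <= dot a (q - p) -> far p q.
Proof.
case: p q => [[p1 p2] p3] [[q1 q2] q3]; rewrite farC /far /dot /=.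
by move: a; apply: dirs_ind; rewrite /= => ?; apply/or3P;
  [apply: Or31|apply: Or31|apply: Or32|apply: Or32|apply: Or33|apply: Or33]; lia.
Qed.

(* A subcube touches at most one face of its parent. *)
Definition in_box (o : vec) := [|| box 5 4 4 o, box 4 5 4 o | box 4 4 5 o].

Lemma in_box_dot o a : in_box o -> a \in dirs -> `|dot a o| <= 5.
Proof.
case: o => [[o1 o2] o3]; rewrite /in_box /box /= => bo.
by move: a; apply: dirs_ind; rewrite /dot /=; lia.
Qed.

Lemma in_box_dot2 o a b : in_box o -> a \in dirs -> b \in dirs -> dot a b = 0 ->
  (`|dot a o| <= 4) || (`|dot b o| <= 4).
Proof.
case: o => [[o1 o2] o3] bo ina; move: b.
by move: a ina; apply: dirs_ind; apply: dirs_ind => // _; move: bo;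
  rewrite /in_box /box /dot /= => /or3P[]/and3P[]; lia.
Qed.

(** A gap of 2 between parents along some axis becomes at least [22 - 5 - 5 = 12]. *)
Lemma far_child p q o o' : far p q -> in_box o -> in_box o' ->
  far (p *+ 11 + o) (q *+ 11 + o').
Proof.
move=> far_pq bo bo'.
have [a ina pq] : exists2 a, a \in dirs & 2 <= dot a (q - p).
  move: far_pq; rewrite farC; case: p q => [[p1 p2] p3] [[q1 q2] q3].
  rewrite /far /dot /= => /or3P[] H.
  - have [|] := leP 0 (q1 - p1) => ?;
      [exists (1, 0, 0) | exists (-1, 0, 0)] => //=; lia.
  - have [|] := leP 0 (q2 - p2) => ?;
      [exists (0, 1, 0) | exists (0, -1, 0)] => //=; lia.
  - have [|] := leP 0 (q3 - p3) => ?;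
      [exists (0, 0, 1) | exists (0, 0, -1)] => //=; lia.
have := in_box_dot bo ina; have := in_box_dot bo' ina.
move=> h h'; apply: (far_dot ina); move: pq.
rewrite !(dotD, dotN, dotMn); move: h h'.
by move: (dot a p) (dot a q) (dot a o) (dot a o') => *; lia.
Qed.

(** One of the two subcubes stays off the common face, so the gap along [a] is at least
    [11 - 5 - 4 = 2]. *)
Lemma far_consecutive p a o o' : a \in dirs -> in_box o -> in_box o' ->
  (dot a o <= 4) || (- 4 <= dot a o') ->
  far (p *+ 11 + o) ((p + a) *+ 11 + o').
Proof.
move=> ina bo bo' h; apply: (far_dot ina).
have := in_box_dot bo ina; have := in_box_dot bo' ina.
rewrite !(dotD, dotN, dotMn) (dot_dir ina); move: h.
by move: (dot a p) (dot a o) (dot a o') => *; lia.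
Qed.

(* At a corner the parents share an edge, but a subcube cannot touch both of
   the faces meeting there. *)
Lemma far_two_steps p a b o o' : turn_ok a b -> in_box o -> in_box o' ->
  far (p *+ 11 + o) ((p + a + b) *+ 11 + o').
Proof.
move=> ab bo bo'; move: a b ab; apply: turn_case => [a ina|a b ina inb ab0].
  apply: (far_dot ina); have := in_box_dot bo ina; have := in_box_dot bo' ina.
  rewrite !(dotD, dotN, dotMn) (dot_dir ina).
  by move: (dot a p) (dot a o) (dot a o') => *; lia.
have ba0 : dot b a = 0.
  by rewrite -ab0 /dot -!(mulrC (a.1.1), mulrC (a.1.2), mulrC a.2).
have := in_box_dot bo' ina; have := in_box_dot bo' inb.
move=> h1 h2; have /orP[h|h] := in_box_dot2 bo ina inb ab0.
  apply: (far_dot ina); rewrite !(dotD, dotN, dotMn) (dot_dir ina) ab0.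
  by move: h h2; move: (dot a p) (dot a o) (dot a o') => *; lia.
apply: (far_dot inb); rewrite !(dotD, dotN, dotMn) (dot_dir inb) ba0.
by move: h h1; move: (dot b p) (dot b o) (dot b o') => *; lia.
Qed.

Lemma pos_subcell c r :
  pos (subcell c r) = pos c *+ 11 + nth 0 (pattern (din c) (dout c)) r.
Proof. by []. Qed.

(** Induction on the level, by the gap between the parents: at least 3 (induction hypothesis), 0
    (the pattern itself), 1 ([far_consecutive]) or 2 ([far_two_steps]). *)
Lemma cells_far k j j' : j + 3 <= j' ->
  far (pos (cells k j)) (pos (cells k j')).
Proof.
elim: k j j' => [|k IHk] j j' jj'; first by rewrite /far /=; lia.
rewrite !cellsS.
have ii' : (j %/ 121)%Z <= (j' %/ 121)%Z by lia.
have rr' : (j %/ 121)%Z = (j' %/ 121)%Z ->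
    (`|(j %% 121)%Z| + 3 <= `|(j' %% 121)%Z|)%N by lia.
(* Indices 3 apart cannot belong to the last subcube of one parent and the first of the next. *)
have rr1' : (j' %/ 121)%Z = (j %/ 121)%Z + 1 ->
    (`|(j %% 121)%Z| < 120)%N \/ (0 < `|(j' %% 121)%Z|)%N by lia.
have : (`|(j %% 121)%Z| < 121)%N by lia.
have : (`|(j' %% 121)%Z| < 121)%N by lia.
move: ii' rr' rr1'; set i := (j %/ 121)%Z; set i' := (j' %/ 121)%Z.
move: `|(j %% 121)%Z|%N `|(j' %% 121)%Z|%N => r r' ii' rr' rr1' r'_lt r_lt.
have bo := pattern_box (cells_turn k i) r_lt.
have bo' := pattern_box (cells_turn k i') r'_lt.
rewrite !pos_subcell.
have [i3|] := leP (i + 3) i'; first by apply: far_child => //; apply: IHk.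
move=> i3; have [e|] := eqVneq i' i.
  rewrite e in rr' *; rewrite far_addl.
  by have := pattern_far (cells_turn k i) (rr' erefl) r'_lt.
move=> i0; have [pS dS] := cells_succ k i.
have [e|i1] := eqVneq i' (i + 1).
  rewrite e pS in bo' *; apply: far_consecutive => //.
    by case/and3P: (cells_turn k i).
  case: (rr1' e) => [r120|r0].
    by rewrite (pattern_exit (cells_turn k i) r120).
  rewrite -dS (pattern_enter (cells_turn k (i + 1))) ?orbT //.
  by rewrite r0.
have e : i' = i + 1 + 1 by lia.
have [pSS _] := cells_succ k (i + 1).
rewrite e pSS pS in bo' *; apply: far_two_steps => //.
by rewrite -dS; apply: cells_turn.
Qed.

(** * The limit curve *)

Lemma coordD i p q : coord i (p + q) = coord i p + coord i q.
Proof. by rewrite /coord; case: (val i) => [|[]]. Qed.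

Lemma coordMn i p n : coord i (p *+ n) = coord i p *+ n.
Proof.
elim: n => [|n IHn]; last by rewrite !mulrS coordD IHn.
by rewrite !mulr0n /coord; case: (val i) => [|[]].
Qed.

Lemma coord_dir i a : a \in dirs -> `|coord i a| <= 1.
Proof.
by move: a; apply: dirs_ind; rewrite /coord; case: (val i) => [|[]].
Qed.

Lemma coord_box i o : in_box o -> `|coord i o| <= 5.
Proof.
case: o => [[o1 o2] o3]; rewrite /in_box /box /coord /=.
by case: (val i) => [|[|_]]; lia.
Qed.

Lemma far_coord p q : far p q -> exists i, 2 <= `|coord i p - coord i q|.
Proof.
by case/or3P => h; [exists (@Ordinal 3 0 isT)|exists (@Ordinal 3 1 isT)|
  exists (@Ordinal 3 2 isT)].
Qed.

Lemma cells_child i k j :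
  `|coord i (pos (cells k.+1 j)) - coord i (pos (cells k (j %/ 121)%Z)) *+ 11|
    <= 5.
Proof.
rewrite cellsS pos_subcell coordD coordMn addrAC subrr add0r.
by apply: coord_box; apply: pattern_box; [exact: cells_turn | lia].
Qed.

Lemma cells_near i k j j' : `|j - j'| <= 1 ->
  `|coord i (pos (cells k j)) - coord i (pos (cells k j'))| <= 1.
Proof.
wlog jj' : j j' / j <= j' => [wlog_jj' jj1|jj1].
  have [/wlog_jj'|/ltW/wlog_jj' h] := leP j j'; first by apply.
  by rewrite distrC; apply: h; rewrite distrC.
have [-> | /eqP jj'0] := eqVneq j j'; first by rewrite subrr.
have -> : j' = j + 1 by lia.
have [-> _] := cells_succ k j; rewrite coordD opprD addNKr normrN.
by apply: coord_dir; case/and3P: (cells_turn k j).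
Qed.

Section Curve.
Variable R : realType.
Implicit Types (t s : R) (i : 'I_3).

Definition cell_index k t : int := Num.floor (t * 121 ^+ k).

Lemma cell_index_le k t : (cell_index k t)%:~R <= t * 121 ^+ k.
Proof. exact: floor_le. Qed.

Lemma cell_index_gt k t : t * 121 ^+ k < (cell_index k t)%:~R + 1.
Proof. by have := floorD1_gt (t * 121 ^+ k); rewrite intrD. Qed.

Lemma cell_indexS k t : (cell_index k.+1 t %/ 121)%Z = cell_index k t.
Proof.
apply/esym/floor_def; rewrite intrD.
have := cell_index_le k.+1 t; have := cell_index_gt k.+1 t; rewrite exprS.
set q := (_ %/ _)%Z.
have e : cell_index k.+1 t = q * 121 + (cell_index k.+1 t %% 121)%Z.
  by rewrite /q; lia.
have r0 : 0 <= ((cell_index k.+1 t %% 121)%Z%:~R : R) by rewrite ler0z; lia.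
have r1 : ((cell_index k.+1 t %% 121)%Z%:~R : R) <= 120.
  by rewrite (_ : 120 = 120%:~R) // ler_int; lia.
rewrite {1 2}e intrD intrM; move: r0 r1 (121 ^+ k) => + + x.
by set y := _%:~R; lra.
Qed.

Definition station i k t : R := (coord i (pos (cells k (cell_index k t))))%:~R.

Definition lower i k t : R := (station i k t - 1 / 2) / 11 ^+ k.
Definition upper i k t : R := (station i k t + 1 / 2) / 11 ^+ k.

(** The intervals are nested because [5 + 1/2 = 11/2]: a child stays inside its parent. *)
Lemma lower_upperS i k t :
  lower i k t <= lower i k.+1 t /\ upper i k.+1 t <= upper i k t.
Proof.
have p0 : 0 < 11 ^+ k :> R by rewrite exprn_gt0.
have := cells_child i k (cell_index k.+1 t); rewrite cell_indexS.
rewrite -(ler_int R) intr_norm intrB rmorphMn.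
rewrite -/(station i k.+1 t) -/(station i k t) ler_norml => /andP[h1 h2].
rewrite /lower /upper exprSr !invfM !mulrA; split.
  rewrite mulrAC ler_pM2r ?invr_gt0 //; lra.
by rewrite [leLHS]mulrAC ler_pM2r ?invr_gt0 //; lra.
Qed.

Lemma lower_le_upper i k l t : lower i k t <= upper i l t.
Proof.
have mono m n : lower i m t <= lower i (m + n) t /\
    upper i (m + n) t <= upper i m t.
  elim: n => [|n [IHl IHu]]; first by rewrite addn0.
  have [hl hu] := lower_upperS i (m + n) t.
  by rewrite addnS; split; [apply: le_trans hl | apply: le_trans IHu].
have [hl _] := mono k l; have [_ hu] := mono l k.
apply: (le_trans hl); apply: le_trans hu; rewrite addnC.
by rewrite /lower /upper ler_pM2r ?invr_gt0 ?exprn_gt0 //; lra.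
Qed.

(** The supremum of the lower ends selects a point common to all the nested intervals. *)
Definition curve t : 'rV[R]_3 :=
  \row_i sup (range (fun k => lower i k t)).

Lemma curve_near i k t : `|curve t 0 i * 11 ^+ k - station i k t| <= 1 / 2.
Proof.
have p0 : 0 < 11 ^+ k :> R by rewrite exprn_gt0.
have ub l : ubound (range (fun k => lower i k t)) (upper i l t).
  by move=> _ [m _ <-]; apply: lower_le_upper.
have h1 : lower i k t <= curve t 0 i.
  by rewrite mxE; apply: ub_le_sup; [exists (upper i 0 t); apply: ub | exists k].
have h2 : curve t 0 i <= upper i k t.
  by rewrite mxE; apply: ge_sup; [exists (lower i 0 t), 0%N | apply: ub].
move: h1 h2; rewrite /lower /upper ler_pdivrMr // ler_pdivlMr // ler_norml.
by move=> ? ?; apply/andP; split; lra.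
Qed.

(** Such times fall in equal or consecutive cubes, whose centres differ by at most 1 in each
    coordinate; the two half sides add 1. *)
Lemma curve_dist_le i k t s : `|t - s| * 121 ^+ k <= 1 ->
  `|curve t 0 i - curve s 0 i| * 11 ^+ k <= 2.
Proof.
have p0 : 0 < 11 ^+ k :> R by rewrite exprn_gt0.
have q0 : 0 < 121 ^+ k :> R by rewrite exprn_gt0.
rewrite -{1}(gtr0_norm q0) -normrM mulrBl ler_norml => /andP[h1 h2].
have near : `|cell_index k t - cell_index k s| <= 1.
  have := cell_index_le k t; have := cell_index_le k s.
  have := cell_index_gt k t; have := cell_index_gt k s => a b c d.
  have : ((cell_index k t - cell_index k s)%:~R : R) < 2%:~R.
    by rewrite intrB; lra.
  have : ((- 2)%:~R : R) < (cell_index k t - cell_index k s)%:~R.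
    by rewrite intrB mulrNz; lra.
  by rewrite !ltr_int; lia.
have := cells_near i k near; rewrite -(ler_int R) intr_norm intrB.
rewrite -/(station i k t) -/(station i k s) -(gtr0_norm p0) -normrM mulrBl.
have := curve_near i k t; have := curve_near i k s.
by rewrite !ler_norml => /andP[? ?] /andP[? ?] /andP[? ?]; apply/andP; split; lra.
Qed.

(** The indices differ by at least 3, so some coordinate separates the centres by 2, of which the
    two half sides take away at most 1. *)
Lemma curve_dist_ge k t s : 4 <= `|t - s| * 121 ^+ k ->
  exists i, 1 <= `|curve t 0 i - curve s 0 i| * 11 ^+ k.
Proof.
wlog ts : t s / t <= s => [wlog_ts|].
  have [/wlog_ts //|/ltW/wlog_ts + h] := leP t s.
  by rewrite distrC => /(_ h) [i]; exists i; rewrite distrC.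
have p0 : 0 < 11 ^+ k :> R by rewrite exprn_gt0.
rewrite distrC ger0_norm ?subr_ge0 // mulrBl => h.
have /(cells_far k)/far_coord[i] : cell_index k t + 3 <= cell_index k s.
  have := cell_index_le k t; have := cell_index_gt k s => a b.
  have : ((cell_index k t + 2)%:~R : R) < (cell_index k s)%:~R.
    by rewrite intrD; lra.
  by rewrite ltr_int; lia.
rewrite -(ler_int R) intr_norm intrB -/(station i k t) -/(station i k s) => far.
exists i; rewrite -(gtr0_norm p0) -normrM mulrBl.
have := curve_near i k t; have := curve_near i k s.
move: far; rewrite !ler_norml !ler_normr => + /andP[? ?] /andP[? ?].
by case/orP => ?; apply/orP; [left|right]; lra.
Qed.

End Curve.

(** * Squared distances along the curve *)

Definition sqdist (R : realType) n (u v : 'rV[R]_n) : R :=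
  \sum_(i < n) (u 0 i - v 0 i) ^+ 2.

Section SqDist.
Variables (R : realType) (n : nat).
Implicit Types u v : 'rV[R]_n.

Lemma sqdist_ge0 u v : 0 <= sqdist u v.
Proof. by apply: sumr_ge0 => i _; apply: sqr_ge0. Qed.

Lemma sqdistC u v : sqdist u v = sqdist v u.
Proof. by apply: eq_bigr => i _; rewrite -sqrrN opprB. Qed.

Lemma sqdist_coord u v i : (u 0 i - v 0 i) ^+ 2 <= sqdist u v.
Proof.
by rewrite /sqdist (bigD1 i) //= lerDl; apply: sumr_ge0 => j _; apply: sqr_ge0.
Qed.

Lemma sqdistZ a u v : sqdist (a *: u) (a *: v) = a ^+ 2 * sqdist u v.
Proof.
by rewrite /sqdist mulr_sumr; apply: eq_bigr => i _; rewrite !mxE; ring.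
Qed.

End SqDist.

Lemma sqdist3E (R : realType) (u v : 'rV[R]_3) : sqdist u v =
  (u 0 0 - v 0 0) ^+ 2 + (u 0 1 - v 0 1) ^+ 2 + (u 0 2%:R - v 0 2%:R) ^+ 2.
Proof.
rewrite /sqdist !big_ord_recl big_ord0 addr0 addrA.
have -> : lift ord0 ord0 = 1 :> 'I_3 by apply: val_inj.
by have -> : lift ord0 (lift ord0 ord0) = 2%:R :> 'I_3 by apply: val_inj.
Qed.

Section CurveBilip.
Variable R : realType.
Implicit Types t s : R.

(** The source of the exponent 1/2: time is divided by 121 while lengths are divided by 11. *)
Lemma exp121 k : (121 : R) ^+ k = (11 ^+ k) ^+ 2.
Proof. by rewrite exprAC; congr (_ ^+ k); ring. Qed.

Lemma scale_exists (tau : R) : 0 < tau -> tau <= 1 ->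
  exists k, tau * 121 ^+ k <= 1 < tau * 121 ^+ k.+1.
Proof.
move=> tau0 tau1; have ex : exists n, 1 < tau * 121 ^+ n.
  exists (Num.truncn tau^-1).+1; rewrite mulrC -ltr_pdivrMr // mul1r.
  apply: (lt_le_trans (truncnS_gt _)); rewrite -natrX ler_nat.
  by apply/ltnW/ltn_expl.
case: (ex_minnP ex) => [[|k]]; first by rewrite expr0 mulr1 ltNge tau1.
move=> h kmin; exists k; rewrite h andbT leNgt.
by apply/negP => /kmin; rewrite ltnn.
Qed.

Lemma curve_sqdist_ge k t s : 4 <= `|t - s| * 121 ^+ k ->
  1 <= sqdist (curve t) (curve s) * 121 ^+ k.
Proof.
have q0 : 0 < 121 ^+ k :> R by rewrite exprn_gt0.
move=> /curve_dist_ge[i h]; have := sqdist_coord (curve t) (curve s) i.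
move/(ler_wpM2r (ltW q0)); apply: le_trans.
by rewrite exp121 -exprMn -real_normK ?num_real // normrM
  (gtr0_norm (exprn_gt0 _ _)) // expr_ge1 // mulr_ge0 ?exprn_ge0.
Qed.

Lemma curve_small t s : `|t - s| <= 1 ->
  `|t - s| <= 14641 * sqdist (curve t) (curve s) /\
  sqdist (curve t) (curve s) <= 14641 * `|t - s|.
Proof.
have [-> _|ts ts1] := eqVneq t s.
  rewrite subrr normr0 mulr0 /sqdist big1 ?mulr0 // => i _.
  by rewrite subrr expr0n.
have tau0 : 0 < `|t - s| by rewrite normr_gt0 subr_eq0.
have [k /andP[k1 k2]] := scale_exists tau0 ts1.
have q0 : 0 < 121 ^+ k :> R by rewrite exprn_gt0.
split.
  (* At level [k + 2] the rescaled gap exceeds 121, hence 4; the two extra levels cost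
     [121 ^ 2 = 14641]. *)
  have : 4 <= `|t - s| * 121 ^+ k.+2.
    by move: k2; rewrite !exprSr; move: (121 ^+ k) => q; lra.
  move/curve_sqdist_ge; rewrite !exprSr => h.
  rewrite -(ler_pM2r q0); apply: (le_trans k1); move: h.
  by move: (sqdist _ _) (121 ^+ k) => Q q; lra.
(* Each of the three rescaled coordinates differs by at most 2. *)
rewrite -(ler_pM2r q0); have : sqdist (curve t) (curve s) * 121 ^+ k <= 12.
  rewrite /sqdist mulr_suml (_ : 12 = \sum_(i < 3) 4); last first.
    by rewrite sumr_const card_ord -mulrnA.
  apply: ler_sum => i _; have := curve_dist_le i k1.
  rewrite exp121 -exprMn -[X in _ -> X <= _]real_normK ?num_real // normrM.
  rewrite [X in _ -> (_ * X) ^+ 2 <= _]gtr0_norm ?exprn_gt0 // => h.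
  have h0 : 0 <= `|curve t 0 i - curve s 0 i| * 11 ^+ k :> R.
    by rewrite mulr_ge0 // exprn_ge0.
  nra.
by move: k2; rewrite exprSr; move: (sqdist _ _) (121 ^+ k) => Q q; lra.
Qed.

(** The cubes of level 0 form a straight row, so [curve t] stays within bounded distance of
    [(t, 0, 0)]. *)
Lemma curve_large t s : 1 <= `|t - s| ->
  (t - s) ^+ 2 <= 14641 * sqdist (curve t) (curve s) /\
  sqdist (curve t) (curve s) <= 14641 * (t - s) ^+ 2.
Proof.
move=> ts1; have near0 (x : R) : let n := (cell_index 0 x)%:~R : R in
    [/\ x - 1 < n, n <= x, `|curve x 0 0 - n| <= 1 / 2,
        `|curve x 0 1| <= 1 / 2 & `|curve x 0 2%:R| <= 1 / 2].
  have := cell_index_le 0 x; have := cell_index_gt 0 x.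
  have := curve_near 0 0 x; have := curve_near 1 0 x.
  have := curve_near 2%:R 0 x; rewrite /station /coord /= expr0 !mulr1 !subr0.
  by move=> ? ? ? ? ?; split=> //; lra.
rewrite -(real_normK (num_real (t - s))).
have [] := near0 t; have [] := near0 s.
move: (cell_index 0 t)%:~R (cell_index 0 s)%:~R => n m.
rewrite !ler_norml => s1 s2 /andP[s3 s4] /andP[s5 s6] /andP[s7 s8].
move=> t1 t2 /andP[t3 t4] /andP[t5 t6] /andP[t7 t8].
split; last first.
  rewrite sqdist3E.
  have : (curve t 0 0 - curve s 0 0) ^+ 2 <= 9 * `|t - s| ^+ 2.
    have : `|curve t 0 0 - curve s 0 0| <= 3 * `|t - s|.
      move: ts1; rewrite ler_norml.
      by case: (ger0P (t - s)) => ? ?; apply/andP; split; lra.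
    rewrite -[X in _ -> X <= _]real_normK ?num_real //.
    by have := normr_ge0 (curve t 0 0 - curve s 0 0); nra.
  have : (curve t 0 1 - curve s 0 1) ^+ 2 <= 1 by nra.
  have : (curve t 0 2%:R - curve s 0 2%:R) ^+ 2 <= 1 by nra.
  by nra.
(* For gaps between 1 and 4 the bounded error could swamp the first coordinate; level 1 gives the
   separation there. *)
have [ts4|ts4] := leP 4 `|t - s|; last first.
  have /curve_sqdist_ge : 4 <= `|t - s| * 121 ^+ 1 by rewrite expr1; lra.
  by rewrite expr1; nra.
apply: (@le_trans _ _ (4 * (curve t 0 0 - curve s 0 0) ^+ 2)); last first.
  have := sqdist_coord (curve t) (curve s) 0.
  by have := sqdist_ge0 (curve t) (curve s); lra.
have : `|t - s| <= 2 * `|curve t 0 0 - curve s 0 0|.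
  move: ts4; case: (ger0P (t - s)) => ? ?;
  by case: (ger0P (curve t 0 0 - curve s 0 0)) => ?; lra.
rewrite -[X in _ -> _ <= 4 * X]real_normK ?num_real //.
by have := normr_ge0 (t - s); nra.
Qed.

Lemma curve_bilip : exists2 K : R, 1 <= K & forall t s,
  (`|t - s| <= 1 -> `|t - s| <= K * sqdist (curve t) (curve s) /\
    sqdist (curve t) (curve s) <= K * `|t - s|) /\
  (1 <= `|t - s| -> (t - s) ^+ 2 <= K * sqdist (curve t) (curve s) /\
    sqdist (curve t) (curve s) <= K * (t - s) ^+ 2).
Proof.
exists 14641; first by rewrite ler1n.
by move=> t s; split; [exact: curve_small | exact: curve_large].
Qed.

End CurveBilip.

(** * The square-root snowflake of the line *)

(** By compactness of [[-M, M]] there is a cluster point, and a cluster point of an ultrafilter is a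
    limit. *)
Lemma ultra_cvg_bounded (R : realType) (T : Type) (U : set_system T)
    (u : T -> R) (M : R) :
  UltraFilter U -> (\forall n \near U, `|u n| <= M) -> exists l : R, u @ U --> l.
Proof.
move=> UU uM; have cM := @segment_compact R (- M) M.
have [] := cM (u @ U) _.
  by rewrite /fmap /=; apply: filterS uM => n ? /=; rewrite in_itv /= -ler_norml.
move=> l [_ cl]; exists l => A Al.
have [//|/= UnA] := in_ultra_setVsetC (u @^-1` A) UU.
by have [x [nAx Ax]] := cl (~` A) A UnA Al.
Qed.

Lemma sqdistB (R : realType) n (u v w : 'rV[R]_n) :
  sqdist (u - w) (v - w) = sqdist u v.
Proof. by apply: eq_bigr => i _; rewrite !mxE; ring. Qed.

(** The rescaled curve [g n] satisfies the estimate for all gaps up to [121 ^ n] with the same [K].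
    One ultrafilter makes all points converge at once, and the estimate passes to the limit. *)
Lemma snowflake (R : realType) : exists (K : R) (f : R -> 'rV[R]_3),
  [/\ 1 <= K, f 0 = 0 & forall t s, `|t - s| <= K * sqdist (f t) (f s) /\
    sqdist (f t) (f s) <= K * `|t - s|].
Proof.
have [K K1 curveK] := curve_bilip R.
have K0 : 0 < K by apply: lt_le_trans K1.
pose g n t := (11 : R) ^+ n *: (curve (t / 121 ^+ n) - curve 0).
have gE n t s : `|t - s| <= 121 ^+ n ->
    `|t - s| <= K * sqdist (g n t) (g n s) /\
    sqdist (g n t) (g n s) <= K * `|t - s|.
  have q0 : 0 < 121 ^+ n :> R by rewrite exprn_gt0.
  move=> ts; rewrite sqdistZ sqdistB -exp121.
  have e : `|t / 121 ^+ n - s / 121 ^+ n| * 121 ^+ n = `|t - s|.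
    by rewrite -mulrBl normrM normfV (gtr0_norm q0) mulfVK // gt_eqF.
  have : `|t / 121 ^+ n - s / 121 ^+ n| <= 1.
    by rewrite -(ler_pM2r q0) e mul1r.
  case/(curveK _ _).1; rewrite -e.
  set d := `|_ - _|; set Q := sqdist _ _.
  move: q0; move: (121 ^+ n) d Q => q d Q q0 h1 h2.
  have := ler_wpM2l (ltW q0) h1; have := ler_wpM2l (ltW q0) h2.
  by split; lra.
have near_g (t s : R) : \forall n \near \oo, `|t - s| <= 121 ^+ n.
  exists (Num.truncn `|t - s|).+1 => // n /= hn.
  apply/ltW/(lt_le_trans (truncnS_gt _)); rewrite -natrX ler_nat.
  by apply: (leq_trans hn); apply/ltnW/ltn_expl.
have /ultraFilterLemma[U [UU oU]] : ProperFilter (\oo : set_system nat).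
  exact: eventually_filter.
have cv t i : exists l : R, g n t 0 i @[n --> U] --> l.
  apply: (ultra_cvg_bounded (M := 1 + K * `|t|)) => //.
  apply: oU; apply: filterS (near_g t 0) => n /gE[_].
  rewrite subr0; have := sqdist_coord (g n t) (g n 0) i.
  have -> : g n 0 = 0 by rewrite /g mul0r subrr scaler0.
  rewrite [X in _ - X]mxE subr0 -(real_normK (num_real (g n t 0 i))).
  move: `|g n t 0 i| => x h1 h2; have := sqr_ge0 (x - 1).
  by have := mulr_ge0 (ltW K0) (normr_ge0 t); lra.
pose f t : 'rV[R]_3 := \row_i xget 0 [set l : R | g n t 0 i @[n --> U] --> l].
have fP t i : g n t 0 i @[n --> U] --> f t 0 i.
  by rewrite mxE; exact: (xgetPex 0 (cv t i)).
(* Subtracting [f 0] normalises the map without appeal to uniqueness of limits. *)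
exists K, (fun t => f t - f 0); split=> // [|t s]; first by rewrite subrr.
 rewrite sqdistB.
have sqc : sqdist (g n t) (g n s) @[n --> U] --> sqdist (f t) (f s).
  rewrite sqdist3E; under eq_fun do rewrite sqdist3E.
  by apply: cvgD; [apply: cvgD|]; apply: cvgM; apply: cvgB.
have tsU := oU _ (near_g t s).
split; last by apply: (cvgr_to_le sqc); apply: filterS tsU => n /gE[].
rewrite -ler_pdivrMl //; apply: (cvgr_to_ge sqc).
by apply: filterS tsU => n /gE[]; rewrite ler_pdivrMl.
Qed.

(** * The cone over the snowflaked circle *)

Lemma sqdist_row_mx (R : realType) m n (u u' : 'rV[R]_m) (v v' : 'rV[R]_n) :
  sqdist (row_mx u v) (row_mx u' v') = sqdist u u' + sqdist v v'.
Proof.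
by rewrite /sqdist big_split_ord; congr (_ + _); apply: eq_bigr => i _;
  rewrite ?row_mxEl ?row_mxEr.
Qed.

Lemma sqdist_const (R : realType) (a b : R) :
  sqdist (const_mx a : 'rV_1) (const_mx b) = (a - b) ^+ 2.
Proof. by rewrite /sqdist big_ord1 !mxE. Qed.

Lemma sqdist_scale2 (R : realType) (u v : 'rV[R]_3) (a b : R) :
  sqdist (a *: u) (b *: v) = a ^+ 2 * sqdist u 0 + b ^+ 2 * sqdist v 0
    - a * b * (sqdist u 0 + sqdist v 0 - sqdist u v).
Proof. by rewrite !sqdist3E !mxE; ring. Qed.

Section Cone.
Variable R : realType.
Implicit Types (u v : 'rV[R]_3) (r s : R).

(** Inverse stereographic projection from the pole [(0, r)] onto the sphere of radius [r] in
    4-space. *)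
Definition sphere r u : 'rV[R]_(3 + 1) :=
  row_mx ((2 * r / (1 + sqdist u 0)) *: u)
    (const_mx (r * (sqdist u 0 - 1) / (1 + sqdist u 0))).

(* The image of the ray missed by the stereographic projection. *)
Definition pole r : 'rV[R]_(3 + 1) := row_mx 0 (const_mx r).

Lemma sqdist_sphere r s u v : sqdist (sphere r u) (sphere s v) =
  (r - s) ^+ 2
  + 4 * r * s * sqdist u v / ((1 + sqdist u 0) * (1 + sqdist v 0)).
Proof.
rewrite sqdist_row_mx sqdist_const sqdist_scale2.
have := sqdist_ge0 u 0; have := sqdist_ge0 v 0.
move: (sqdist u 0) (sqdist v 0) (sqdist u v) => U V D V0 U0.
by field; rewrite !gt_eqF //; lra.
Qed.

Lemma sqdist_sphere_pole r s u : sqdist (sphere r u) (pole s) =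
  (r - s) ^+ 2 + 4 * r * s / (1 + sqdist u 0).
Proof.
rewrite sqdist_row_mx sqdist_const.
have -> a : sqdist (a *: u) 0 = a ^+ 2 * sqdist u 0 by rewrite -sqdistZ scaler0.
have := sqdist_ge0 u 0; move: (sqdist u 0) => U U0.
by field; rewrite !gt_eqF //; lra.
Qed.

Lemma sqdist_pole r s : sqdist (pole r) (pole s) = (r - s) ^+ 2.
Proof.
by rewrite sqdist_row_mx sqdist_const sqdist3E !subrr !expr0n !add0r.
Qed.

Variables (K : R) (f : R -> 'rV[R]_3).
Hypothesis K1 : 1 <= K.
Hypothesis f0 : f 0 = 0.
Hypothesis fK : forall t s,
  `|t - s| <= K * sqdist (f t) (f s) /\ sqdist (f t) (f s) <= K * `|t - s|.

Lemma snowflake_sqr t s :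
  (t - s) ^+ 2 <= K ^+ 2 * sqdist (f t) (f s) ^+ 2 /\
  sqdist (f t) (f s) ^+ 2 <= K ^+ 2 * (t - s) ^+ 2.
Proof.
have [h1 h2] := fK t s; have Q0 := sqdist_ge0 (f t) (f s).
rewrite -(real_normK (num_real (t - s))) -!exprMn.
have K0 : 0 <= K by apply: le_trans K1.
by split; rewrite ler_sqr ?nnegrE // mulr_ge0.
Qed.

(** These are the stereographic factors of the 3-sphere and of the circle; their comparability
    carries the snowflake estimate from the line to the circle. *)
Lemma snowflake_weight t (A := (1 + sqdist (f t) 0) ^+ 2) :
  1 + t ^+ 2 <= K ^+ 2 * A /\ A <= 2 * K ^+ 2 * (1 + t ^+ 2).
Proof.
have [] := snowflake_sqr t 0; have Q0 := sqdist_ge0 (f t) 0.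
rewrite f0 subr0 /A; move: (sqdist _ _) Q0 => Q Q0 h1 h2.
have KK : 1 <= K ^+ 2 by rewrite exprn_ege1.
have KQ : 0 <= K ^+ 2 * Q by rewrite mulr_ge0 ?sqr_ge0.
by have := sqr_ge0 (Q - 1); split; lra.
Qed.

(** [X / (r - Y)] is the stereographic coordinate of the direction of [(X, Y)]. The exceptional ray
    [r = Y] includes the origin, which goes to [pole 0]. *)
Definition cone (X Y : R) : 'rV[R]_(3 + 1) :=
  let r := Num.sqrt (X ^+ 2 + Y ^+ 2) in
  if r == Y then pole r else sphere r (f (X / (r - Y))).

Lemma stereographic (X Y r : R) : 0 <= r -> r ^+ 2 = X ^+ 2 + Y ^+ 2 -> r != Y ->
  let m := r - Y in let x := X / m in
  [/\ 0 < m, X = x * m & 2 * r = m * (1 + x ^+ 2)].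
Proof.
move=> r0 rE rY m x; have m0 : 0 < m.
  by rewrite /m subr_gt0 lt_neqAle eq_sym rY /=; nra.
split=> //; first by rewrite /x mulfVK // gt_eqF.
have -> : 2 * r = m + X ^+ 2 / m.
  have -> : X ^+ 2 = m * (r + Y) by rewrite /m; nra.
  by rewrite mulrAC mulfV ?gt_eqF // mul1r /m; ring.
by rewrite /x; field; rewrite gt_eqF.
Qed.

(** Here [b] is [r * r'] times a squared chord of the unit 3-sphere, and [w] is [(r * r') ^ 2] times
    a squared chord of the unit circle. One factor [K ^ 2] comes from [f], two from the weights. *)
Lemma sphere_angle (r r' m m' x x' : R) :
  0 <= r -> 0 <= r' -> 0 < m -> 0 < m' ->
  2 * r = m * (1 + x ^+ 2) -> 2 * r' = m' * (1 + x' ^+ 2) ->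
  let b := 4 * r * r' * sqdist (f x) (f x')
    / ((1 + sqdist (f x) 0) * (1 + sqdist (f x') 0)) in
  let w := r * r' * (m * m' * (x - x') ^+ 2) in
  b ^+ 2 <= 4 * K ^+ 6 * w /\ w <= 4 * K ^+ 6 * b ^+ 2.
Proof.
move=> r0 r0' m0 m0' rE rE' /=.
have [d1 d2] := snowflake_sqr x x'.
have [a1 a2] := snowflake_weight x; have [a1' a2'] := snowflake_weight x'.
have := sqdist_ge0 (f x) 0; have := sqdist_ge0 (f x') 0.
move: a1 a2 a1' a2' d1 d2.
move: (sqdist (f x) (f x')) (sqdist (f x) _) (sqdist (f x') _) => D U V.
move=> a1 a2 a1' a2' d1 d2 V0 U0.
set b := 4 * r * r' * D / _.
have bE : b ^+ 2 * ((1 + U) ^+ 2 * (1 + V) ^+ 2) = 16 * (r * r') ^+ 2 * D ^+ 2.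
  by rewrite /b; field; rewrite !gt_eqF //; lra.
have cE : r * r' * (m * m' * (x - x') ^+ 2) * ((1 + x ^+ 2) * (1 + x' ^+ 2)) =
    4 * (r * r') ^+ 2 * (x - x') ^+ 2.
  transitivity (r * r' * (m * (1 + x ^+ 2)) * (m' * (1 + x' ^+ 2)) *
    (x - x') ^+ 2); first by ring.
  by rewrite -rE -rE'; ring.
move: cE bE; set c := r * r' * _; set P := (r * r') ^+ 2.
have P0 : 0 <= P by apply: sqr_ge0.
have c0 : 0 <= c.
  apply: mulr_ge0; first exact: mulr_ge0.
  by apply: mulr_ge0; [apply/ltW/mulr_gt0 | apply: sqr_ge0].
move: a1 a2 a1' a2'; have : 0 < (1 + U) ^+ 2 by rewrite exprn_gt0 //; lra.
have : 0 < (1 + V) ^+ 2 by rewrite exprn_gt0 //; lra.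
have : 0 < 1 + x ^+ 2 by rewrite ltr_pwDl // sqr_ge0.
have : 0 < 1 + x' ^+ 2 by rewrite ltr_pwDl // sqr_ge0.
move: (1 + x ^+ 2) (1 + x' ^+ 2) ((1 + U) ^+ 2) ((1 + V) ^+ 2) => E E' A A'.
move: (b ^+ 2) (sqr_ge0 b) (D ^+ 2) ((x - x') ^+ 2) d1 d2 => B B0 G H d1 d2.
move=> E0' E0 A0' A0 a1 a2 a1' a2' cE bE.
have K0 : 0 <= K ^+ 2 by apply: sqr_ge0.
have K6 : K ^+ 6 = K ^+ 2 * (K ^+ 2 * K ^+ 2) by ring.
move: (K ^+ 2) K0 K6 a1 a2 a1' a2' d1 d2 => k k0 -> a1 a2 a1' a2' d1 d2.
have EA : E * E' <= (k * A) * (k * A') by apply: ler_pM => //; apply: ltW.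
have AE : A * A' <= (2 * k * E) * (2 * k * E') by apply: ler_pM => //; apply: ltW.
split.
  rewrite -(ler_pM2r (mulr_gt0 A0 A0')) bE.
  have h1 : 16 * P * G <= 16 * P * (k * H) by apply: ler_wpM2l => //; lra.
  have h2 : c * (E * E') <= c * (k * A * (k * A')) by apply: ler_wpM2l.
  have := ler_wpM2l k0 h2; rewrite cE; lra.
rewrite -(ler_pM2r (mulr_gt0 E0 E0')) cE.
have h1 : 4 * P * H <= 4 * P * (k * G) by apply: ler_wpM2l => //; lra.
have h2 : B * (A * A') <= B * (2 * k * E * (2 * k * E')) by apply: ler_wpM2l.
have := ler_wpM2l k0 h2; rewrite bE => h3.
have : 0 <= k * (k * k) * (B * (E * E')).
  by rewrite !mulr_ge0 // ltW.
lra.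
Qed.

(** The limit of [sphere_angle] as [x'] tends to infinity with [r'] fixed, where [m' * (x - x') ^ 2]
    tends to [2 * r']. *)
Lemma pole_angle (r r' m x : R) : 0 <= r -> 0 <= r' -> 0 < m ->
  2 * r = m * (1 + x ^+ 2) ->
  let b := 4 * r * r' / (1 + sqdist (f x) 0) in
  let w := r * r' * (2 * r' * m) in
  b ^+ 2 <= 4 * K ^+ 6 * w /\ w <= 4 * K ^+ 6 * b ^+ 2.
Proof.
move=> r0 r0' m0 rE /=.
have [a1 a2] := snowflake_weight x; have := sqdist_ge0 (f x) 0.
move: a1 a2; move: (sqdist (f x) _) => U a1 a2 U0.
set b := 4 * r * r' / _; set w := r * r' * _.
have bE : b ^+ 2 * (1 + U) ^+ 2 = 16 * (r * r') ^+ 2.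
  by rewrite /b; field; rewrite gt_eqF //; lra.
have wE : w * (1 + x ^+ 2) = 4 * (r * r') ^+ 2.
  transitivity (2 * r * r' ^+ 2 * (m * (1 + x ^+ 2))); first by rewrite /w; ring.
  by rewrite -rE; ring.
have w0 : 0 <= w.
  by apply: mulr_ge0; [exact: mulr_ge0 | rewrite !mulr_ge0 // ltW].
have B0 := sqr_ge0 b.
have K2 : 1 <= K ^+ 2 by rewrite exprn_ege1.
have K6 : K ^+ 2 <= K ^+ 6.
  by rewrite ler_weXn2l.
move: a1 a2; have : 0 < (1 + U) ^+ 2 by rewrite exprn_gt0 //; lra.
have : 0 < 1 + x ^+ 2 by rewrite ltr_pwDl // sqr_ge0.
move: (b ^+ 2) B0 (1 + x ^+ 2) ((1 + U) ^+ 2) bE wE => B B0 E A bE wE E0 A0 a1 a2.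
move: (K ^+ 2) (K ^+ 6) K2 K6 a1 a2 => k l k1 kl a1 a2.
split.
  apply: (@le_trans _ _ (4 * k * w)); last by rewrite ler_wpM2r // ler_wpM2l.
  rewrite -(ler_pM2r A0) bE; have := ler_wpM2l w0 a1; lra.
apply: (@le_trans _ _ (4 * k * B)); last by rewrite ler_wpM2r // ler_wpM2l.
rewrite -(ler_pM2r E0) wE; have := ler_wpM2l B0 a2.
have : 0 <= B * (k * E) by rewrite !mulr_ge0 //; lra.
lra.
Qed.

(* In polar coordinates both sides split as [(r - r') ^ 2] plus an angular part:
   [b] for the image and, for the plane, the factor [2 (r r' - X X' - Y Y')] of
   [w]. *)
Lemma cone_angle (X Y X' Y' : R) (r := Num.sqrt (X ^+ 2 + Y ^+ 2))
    (r' := Num.sqrt (X' ^+ 2 + Y' ^+ 2))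
    (w := r * r' * (2 * (r * r' - X * X' - Y * Y'))) :
  exists b, [/\ 0 <= b, sqdist (cone X Y) (cone X' Y') = (r - r') ^+ 2 + b,
    b ^+ 2 <= 4 * K ^+ 6 * w & w <= 4 * K ^+ 6 * b ^+ 2].
Proof.
have r0 : 0 <= r := sqrtr_ge0 _.
have r0' : 0 <= r' := sqrtr_ge0 _.
have rE : r ^+ 2 = X ^+ 2 + Y ^+ 2 by rewrite sqr_sqrtr // addr_ge0 ?sqr_ge0.
have rE' : r' ^+ 2 = X' ^+ 2 + Y' ^+ 2 by rewrite sqr_sqrtr // addr_ge0 ?sqr_ge0.
have X0 (Z W s : R) : s ^+ 2 = Z ^+ 2 + W ^+ 2 -> s = W -> Z = 0.
  by move=> + sW; rewrite sW => h; apply/eqP; rewrite -sqrf_eq0; apply/eqP; lra.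
have U0 (x : R) : 0 < 1 + sqdist (f x) 0 by rewrite ltr_pwDl // sqdist_ge0.
rewrite /cone -/r -/r'.
move: (r) (r') @w r0 r0' rE rE' => {r r'} r r' w r0 r0' rE rE'.
have [rY|rY] := eqVneq r Y; have [rY'|rY'] := eqVneq r' Y'.
- exists 0; rewrite sqdist_pole addr0 expr0n mulr0.
  suff -> : w = 0 by rewrite mulr0.
  by rewrite /w (X0 _ _ _ rE rY) -rY -rY'; ring.
- have [m0 XE rm] := stereographic r0' rE' rY'.
  rewrite sqdistC sqdist_sphere_pole.
  have [] := pole_angle r0' r0 m0 rm.
  set b := _ / _ => b1 b2; exists b; split.
  + by rewrite divr_ge0 ?mulr_ge0 // ltW.
  + by rewrite -[in RHS]opprB sqrrN.
  + apply: (le_trans b1); rewrite le_eqVlt; apply/orP; left; apply/eqP.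
    by rewrite /w (X0 _ _ _ rE rY) -rY; ring.
  + apply: le_trans b2; rewrite le_eqVlt; apply/orP; left; apply/eqP.
    by rewrite /w (X0 _ _ _ rE rY) -rY; ring.
- have [m0 XE rm] := stereographic r0 rE rY.
  rewrite sqdist_sphere_pole.
  have [] := pole_angle r0 r0' m0 rm.
  set b := _ / _ => b1 b2; exists b; split=> //.
  + by rewrite divr_ge0 ?mulr_ge0 // ltW.
  + apply: (le_trans b1); rewrite le_eqVlt; apply/orP; left; apply/eqP.
    by rewrite /w (X0 _ _ _ rE' rY') -rY'; ring.
  + apply: le_trans b2; rewrite le_eqVlt; apply/orP; left; apply/eqP.
    by rewrite /w (X0 _ _ _ rE' rY') -rY'; ring.
have [m0 XE rm] := stereographic r0 rE rY.
have [m0' XE' rm'] := stereographic r0' rE' rY'.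
rewrite sqdist_sphere; have [] := sphere_angle r0 r0' m0 m0' rm rm'.
set b := _ / _ => b1 b2; exists b.
(* The squared chord of the circle, rewritten in stereographic coordinates. *)
have wE : r * r' * ((r - Y) * (r' - Y') * (X / (r - Y) - X' / (r' - Y')) ^+ 2)
    = w.
  rewrite /w; congr (_ * _).
  move: XE XE' rm rm'; set x := X / _; set x' := X' / _.
  set m := r - Y; set m' := r' - Y' => XE XE' rm rm'.
  have YE : Y = r - m by rewrite /m; ring.
  have YE' : Y' = r' - m' by rewrite /m'; ring.
  rewrite {1}XE {1}XE' {1}YE {1}YE'.
  transitivity (2 * r * m' + 2 * r' * m - 2 * m * m' * (1 + x * x'));
    last by ring.
  by rewrite rm rm'; ring.
rewrite wE in b1 b2; split=> //.
by rewrite divr_ge0 ?mulr_ge0 ?sqdist_ge0 // ltW.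
Qed.

(** With [d = (r - r') ^ 2] and [P = r * r'], Lagrange's identity gives [E = d ^ 2 + 2 d c + 4 P c],
    while [Q = d + b] with [b ^ 2] comparable to [P c]. The mixed terms are absorbed using
    [c ^ 2 <= 4 P c]. *)
Lemma cone_bilip (X Y X' Y' : R)
    (E := ((X - X') ^+ 2 + (Y - Y') ^+ 2) ^+ 2 + 4 * (X * Y' - X' * Y) ^+ 2)
    (Q := sqdist (cone X Y) (cone X' Y')) :
  E <= 32 * K ^+ 6 * Q ^+ 2 /\ Q ^+ 2 <= 32 * K ^+ 6 * E.
Proof.
have [b []] := cone_angle X Y X' Y'; rewrite /Q => b0 ->.
set r := Num.sqrt (X ^+ 2 + _); set r' := Num.sqrt (X' ^+ 2 + _).
have r0 : 0 <= r := sqrtr_ge0 _.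
have r0' : 0 <= r' := sqrtr_ge0 _.
have rE : r ^+ 2 = X ^+ 2 + Y ^+ 2 by rewrite sqr_sqrtr // addr_ge0 ?sqr_ge0.
have rE' : r' ^+ 2 = X' ^+ 2 + Y' ^+ 2 by rewrite sqr_sqrtr // addr_ge0 ?sqr_ge0.
set c := 2 * _; set P := r * r'.
have cross : (X * Y' - X' * Y) ^+ 2 = P * c - c ^+ 2 / 4.
  have -> : P * c - c ^+ 2 / 4 = r ^+ 2 * r' ^+ 2 - (X * X' + Y * Y') ^+ 2.
    by rewrite /P /c; field.
  by rewrite rE rE'; ring.
have c0 : 0 <= c.
  have dotP : (X * X' + Y * Y') ^+ 2 <= P ^+ 2.
    have -> : P ^+ 2 = (X ^+ 2 + Y ^+ 2) * (X' ^+ 2 + Y' ^+ 2).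
      by rewrite -rE -rE' /P; ring.
    by rewrite -subr_ge0; have := sqr_ge0 (X * Y' - X' * Y); lra.
  have P0 : 0 <= P by apply: mulr_ge0.
  rewrite /c -addrA -opprD mulr_ge0 // subr_ge0.
  rewrite leNgt; apply/negP => h; move: dotP; apply/negP; rewrite -ltNge.
  by rewrite ltr_sqr ?nnegrE // ltW // (le_lt_trans P0).
have -> : E = ((r - r') ^+ 2) ^+ 2 + 2 * (r - r') ^+ 2 * c + 4 * (P * c).
  rewrite /E cross.
  have -> : (X - X') ^+ 2 + (Y - Y') ^+ 2 = (r - r') ^+ 2 + c.
    have -> : (r - r') ^+ 2 + c = r ^+ 2 + r' ^+ 2 - 2 * (X * X' + Y * Y').
      by rewrite /c; ring.
    by rewrite rE rE'; ring.
  by field.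
have cP : c ^+ 2 <= 4 * (P * c).
  by have := sqr_ge0 (X * Y' - X' * Y); rewrite cross; lra.
have := sqr_ge0 (r - r'); move: ((r - r') ^+ 2) (P * c) cP => d w cP d0 b1 b2.
have L1 : 1 <= K ^+ 6 by rewrite exprn_ege1.
move: (K ^+ 6) L1 b1 b2 => L L1 b1 b2.
have dc0 : 0 <= d * c by apply: mulr_ge0.
have db0 : 0 <= d * b by apply: mulr_ge0.
have dc := sqr_ge0 (d - c); have db := sqr_ge0 (d - b).
have w0 : 0 <= w by have := sqr_ge0 c; lra.
have Ld : d ^+ 2 <= L * d ^+ 2 by rewrite ler_peMl ?sqr_ge0.
have Ldb : 0 <= L * (d * b) by rewrite mulr_ge0 //; lra.
have Ldc : 0 <= L * (d * c) by rewrite mulr_ge0 //; lra.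
have Lb : b ^+ 2 <= L * b ^+ 2 by rewrite ler_peMl ?sqr_ge0.
have Lw : w <= L * w by rewrite ler_peMl.
by have := sqr_ge0 d; have := sqr_ge0 b; split; lra.
Qed.

End Cone.

(** * Lines and planes of the Heisenberg group *)

Lemma expr4E (R : pzRingType) (x : R) : x ^+ 4 = (x ^+ 2) ^+ 2.
Proof. by rewrite -exprM. Qed.

Lemma row3P (u v : 'rV[RR]_3) :
  hx u = hx v -> hy u = hy v -> hz u = hz v -> u = v.
Proof.
move=> hxE hyE hzE; apply/rowP => -[[|[|[|//]]] i3].
- by have -> : Ordinal i3 = c0 by apply: val_inj.
- by have -> : Ordinal i3 = c1 by apply: val_inj.
- by have -> : Ordinal i3 = c2 by apply: val_inj.
Qed.

(** The quadratic term dominates for gaps below 1, the quartic one above; hence the factor 2. *)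
Lemma curve_quartic (R : realType) : exists2 K : R, 1 <= K & forall t s,
  (t - s) ^+ 4 + (t - s) ^+ 2 <= K * sqdist (curve t) (curve s) ^+ 2 /\
  sqdist (curve t) (curve s) ^+ 2 <= K * ((t - s) ^+ 4 + (t - s) ^+ 2).
Proof.
have [K K1 curveK] := curve_bilip R.
have K0 : 0 <= K by apply: le_trans K1.
have KK : 1 <= K ^+ 2 by rewrite exprn_ege1.
exists (2 * K ^+ 2) => [|t s]; first by lra.
have [small large] := curveK t s; have Q0 := sqdist_ge0 (curve t) (curve s).
have x4 : (t - s) ^+ 4 = `|t - s| ^+ 4.
  by rewrite !expr4E real_normK ?num_real.
move: small large; rewrite -(real_normK (num_real (t - s))) x4.
move: `|t - s| (normr_ge0 (t - s)) Q0 => x x0.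
move: (sqdist _ _) => Q Q0 small large.
have [x1|/ltW x1] := leP x 1.
  have [h1 h2] := small x1.
  have h1' : x ^+ 2 <= (K * Q) ^+ 2 by rewrite ler_sqr ?nnegrE ?mulr_ge0.
  have h2' : Q ^+ 2 <= (K * x) ^+ 2 by rewrite ler_sqr ?nnegrE ?mulr_ge0.
  have h3 : x ^+ 4 <= x ^+ 2 by rewrite ler_wiXn2l.
  rewrite exprMn in h1'; rewrite exprMn in h2'.
  have h4 : 0 <= K ^+ 2 * x ^+ 4 by rewrite !mulr_ge0 ?exprn_ge0.
  have h5 : 0 <= K ^+ 2 * x ^+ 2 by rewrite !mulr_ge0 ?exprn_ge0.
  by split; lra.
have [h1 h2] := large x1.
have h1' : (x ^+ 2) ^+ 2 <= (K * Q) ^+ 2.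
  by rewrite ler_sqr ?nnegrE ?mulr_ge0 ?sqr_ge0.
have h2' : Q ^+ 2 <= (K * x ^+ 2) ^+ 2.
  by rewrite ler_sqr ?nnegrE ?mulr_ge0 ?sqr_ge0.
have h3 : x ^+ 2 <= x ^+ 4 by rewrite ler_weXn2l.
rewrite exprMn in h1'; rewrite exprMn in h2'.
have h4 : 0 <= K ^+ 2 * x ^+ 4 by rewrite !mulr_ge0 ?exprn_ge0.
have h5 : 0 <= K ^+ 2 * x ^+ 2 by rewrite !mulr_ge0 ?exprn_ge0.
by split; lra.
Qed.

(** Rescaling parameter and target makes [K] independent of [A] and [g]. The degenerate cases are a
    straight line ([g = 0]) and the snowflake ([A = 0]). *)
Lemma line_embedding (R : realType) : exists2 K : R, 1 <= K &
  forall A g : R, 0 <= A -> exists h : R -> 'rV[R]_3, forall t s,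
  let E := A ^+ 2 * (t - s) ^+ 4 + 16 * g ^+ 2 * (t - s) ^+ 2 in
  E <= K * sqdist (h t) (h s) ^+ 2 /\ sqdist (h t) (h s) ^+ 2 <= K * E.
Proof.
have [K K1 curveK] := curve_quartic R.
have [L [f [L1 _ fL]]] := snowflake R.
have LL : 1 <= L ^+ 2 by rewrite exprn_ege1.
exists (K + L ^+ 2) => [|A g A0]; first by lra.
have weaken (E Q M : R) : 0 <= E -> M <= K + L ^+ 2 ->
    E <= M * Q ^+ 2 /\ Q ^+ 2 <= M * E ->
    E <= (K + L ^+ 2) * Q ^+ 2 /\ Q ^+ 2 <= (K + L ^+ 2) * E.
  move=> E0 M_le [h1 h2]; split.
    by apply: (le_trans h1); rewrite ler_wpM2r ?sqr_ge0.
  by apply: (le_trans h2); rewrite ler_wpM2r.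
have E0 t s : 0 <= A ^+ 2 * (t - s) ^+ 4 + 16 * g ^+ 2 * (t - s) ^+ 2.
  rewrite expr4E; have := mulr_ge0 (sqr_ge0 A) (sqr_ge0 ((t - s) ^+ 2)).
  by have := mulr_ge0 (sqr_ge0 g) (sqr_ge0 (t - s)); lra.
have [->|gN0] := eqVneq g 0.
  exists (fun t => \row_i (if i == 0 then Num.sqrt A * t else 0)) => t s /=.
  have -> : sqdist (\row_i (if i == 0 then Num.sqrt A * t else 0))
      (\row_i (if i == 0 then Num.sqrt A * s else 0) : 'rV_3) = A * (t - s) ^+ 2.
    rewrite sqdist3E !mxE /= -[in RHS](sqr_sqrtr A0); ring.
  rewrite expr0n /= mulr0 mul0r addr0 expr4E -exprMn.
  by split; rewrite ler_peMl ?sqr_ge0 //; lra.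
have [AE|AN0] := eqVneq A 0.
  exists (fun t => Num.sqrt (4 * `|g|) *: f t) => t s /=.
  apply: (weaken _ _ (L ^+ 2)) => //; first by lra.
  rewrite sqdistZ sqr_sqrtr ?mulr_ge0 // exprMn exprMn real_normK ?num_real //.
  rewrite AE expr0n mul0r add0r.
  have [] := snowflake_sqr L1 fL t s.
  move: (sqdist _ _ ^+ 2) ((t - s) ^+ 2) => Q x h1 h2.
  have G0 := sqr_ge0 g.
  by have := ler_wpM2l G0 h1; have := ler_wpM2l G0 h2; split; lra.
have A0' : 0 < A by rewrite lt_neqAle eq_sym AN0.
(* The gap at which the quartic and the quadratic term are equal; it is rescaled to 1. *)
pose l := 4 * `|g| / A; have l0 : 0 < l.
  by rewrite divr_gt0 ?mulr_gt0 ?normr_gt0.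
have gE : 16 * g ^+ 2 = A ^+ 2 * l ^+ 2.
  rewrite -(real_normK (num_real g)) /l.
  by move: `|g| => y; field.
clearbody l; exists (fun t => (Num.sqrt A * l) *: curve (t / l)) => t s /=.
apply: (weaken _ _ K) => //; first by lra.
rewrite sqdistZ !exprMn sqr_sqrtr //.
have -> : A ^+ 2 * (t - s) ^+ 4 + 16 * g ^+ 2 * (t - s) ^+ 2 =
    A ^+ 2 * l ^+ 4 * ((t / l - s / l) ^+ 4 + (t / l - s / l) ^+ 2).
  by rewrite gE; field; rewrite gt_eqF.
have [] := curveK (t / l) (s / l).
have : 0 <= A ^+ 2 * l ^+ 4 by rewrite mulr_ge0 ?exprn_ge0 // ltW.
move: (sqdist _ _) (_ ^+ 4 + _ ^+ 2) => Q x M0 h1 h2.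
by have := ler_wpM2l M0 h1; have := ler_wpM2l M0 h2; split; lra.
Qed.

Definition dK4 (p q : 'rV[RR]_3) : RR :=
  ((hx p - hx q) ^+ 2 + (hy p - hy q) ^+ 2) ^+ 2
  + 16 * (hz p - hz q + (hx p * hy q - hx q * hy p) / 2) ^+ 2.

(** Multiplying a distance by [K] multiplies its fourth power by [K ^ 4 >= K]. *)
Lemma LipConst_le (X : set 'rV[RR]_3) n (f : 'rV[RR]_3 -> 'rV[RR]_n) (K : RR) :
  1 <= K ->
  (forall a b, X a -> X b -> dK4 a b <= K * sqdist (f a) (f b) ^+ 2 /\
    sqdist (f a) (f b) ^+ 2 <= K * dK4 a b) ->
  (LipConst X dK (@deucl n) <= K%:E)%E.
Proof.
move=> K1 fK; apply: ereal_inf_lbound; exists K => //; split=> //; exists f.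
move=> a b Xa Xb; have [h1 h2] := fK a b Xa Xb.
have K0 : 0 < K by apply: lt_le_trans K1.
have Q0 := sqdist_ge0 (f a) (f b).
have E0 : 0 <= dK4 a b by rewrite /dK4 addr_ge0 ?sqr_ge0 // mulr_ge0 ?sqr_ge0.
have K4 : K <= K ^+ 4 by rewrite ler_eXnr.
have sqrt_scale (x : RR) : 0 <= x -> K * Num.sqrt (Num.sqrt x) =
    Num.sqrt (Num.sqrt (K ^+ 4 * x)).
  move=> x0; rewrite sqrtrM ?exprn_ge0 ?ltW // expr4E sqrtr_sqr.
  by rewrite sqrtrM ?normr_ge0 // ger0_norm ?sqr_ge0 // sqrtr_sqr gtr0_norm.
have sqrtQ : deucl (f a) (f b) = Num.sqrt (Num.sqrt (sqdist (f a) (f b) ^+ 2)).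
  by rewrite sqrtr_sqr ger0_norm.
rewrite sqrtQ -[dK a b]/(Num.sqrt (Num.sqrt (dK4 a b))) ler_pdivrMl //.
rewrite !sqrt_scale ?sqr_ge0 // !ler_wsqrtr //.
  by apply: (le_trans h2); rewrite ler_wpM2r.
by apply: (le_trans h1); rewrite ler_wpM2r ?sqr_ge0.
Qed.

Lemma line_LipConst : exists2 K : RR, 1 <= K &
  forall l, is_line l -> (LipConst l dK (@deucl 3) <= K%:E)%E.
Proof.
have [K K1 embK] := line_embedding RR; exists K => // _ [p [v [v0 ->]]].
pose A := hx v ^+ 2 + hy v ^+ 2.
(* The vertical component of the direction after left translation of [p] to the origin. *)
pose g := hz v + (hx v * hy p - hy v * hx p) / 2.
have A0 : 0 <= A by rewrite addr_ge0 ?sqr_ge0.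
have [h hK] := embK A g A0.
have [i vi] : exists i, v ord0 i != 0.
  apply/existsP; apply: contraNT v0 => /existsPn v0.
  by apply/eqP/rowP => i; rewrite mxE; apply/eqP; have := v0 i; rewrite negbK.
pose f (q : 'rV[RR]_3) := h ((q ord0 i - p ord0 i) / v ord0 i).
apply: (LipConst_le (f := f)) => //.
move=> _ _ [t _ <-] [s _ <-].
have par x : ((p + x *: v) ord0 i - p ord0 i) / v ord0 i = x.
  by rewrite !mxE addrAC subrr add0r mulfK.
rewrite /f !par; have -> // : dK4 (p + t *: v) (p + s *: v) =
  A ^+ 2 * (t - s) ^+ 4 + 16 * g ^+ 2 * (t - s) ^+ 2.
by rewrite /dK4 /hx /hy /hz !mxE -/(hx p) -/(hy p) -/(hz p) -/(hx v) -/(hy v)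
  -/(hz v) /A /g; field.
Qed.

(** On such a set [dK4] is [(r - r') ^ 4 + 16 * (zeta q - zeta q') ^ 2], a line times a snowflaked
    line. *)
Lemma vertical_LipConst : exists2 K : RR, 1 <= K &
  forall (X : set 'rV[RR]_3) (a b x0 y0 : RR), a ^+ 2 + b ^+ 2 = 1 ->
  (forall q, X q -> exists r, hx q = x0 + r * a /\ hy q = y0 + r * b) ->
  (LipConst X dK (@deucl 4) <= K%:E)%E.
Proof.
have [K [f [K1 _ fK]]] := snowflake RR.
have KK : 1 <= K ^+ 2 by rewrite exprn_ege1.
exists (16 * K ^+ 2); first by lra.
move=> X a b x0 y0 ab XP.
pose rho q := a * hx q + b * hy q.
(* The height of [q] after a left translation to a plane through the axis. *)
pose zeta q := hz q + (hx q * y0 - hy q * x0) / 2.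
pose F q : 'rV[RR]_(1 + 3) := row_mx (const_mx (rho q)) (f (zeta q)).
apply: (LipConst_le (X := X) (f := F)) => [|q q']; first by lra.
move=> /XP[r [qx qy]] /XP[r' [qx' qy']].
have rE : rho q - rho q' = r - r'.
  rewrite /rho qx qy qx' qy'; transitivity ((r - r') * (a ^+ 2 + b ^+ 2)).
    by ring.
  by rewrite ab mulr1.
have -> : dK4 q q' = (r - r') ^+ 4 + 16 * (zeta q - zeta q') ^+ 2.
  rewrite /dK4 /zeta qx qy qx' qy'; congr (_ + 16 * _ ^+ 2); last by field.
  transitivity ((r - r') ^+ 4 * (a ^+ 2 + b ^+ 2) ^+ 2); first by ring.
  by rewrite ab expr1n mulr1.
rewrite /F sqdist_row_mx sqdist_const rE.
have [] := snowflake_sqr K1 fK (zeta q) (zeta q').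
have := sqdist_ge0 (f (zeta q)) (f (zeta q')).
have -> : (r - r') ^+ 4 = ((r - r') ^+ 2) ^+ 2 by ring.
have := sqr_ge0 (r - r'); move: ((r - r') ^+ 2) (sqdist _ _) => d D d0 D0.
move: (_ ^+ 2) (sqr_ge0 (zeta q - zeta q')) => z z0 h1 h2.
have dD : 0 <= d * D by apply: mulr_ge0.
have K0 : 0 <= K ^+ 2 by lra.
have := sqr_ge0 (d - D); have := mulr_ge0 K0 dD; have := mulr_ge0 K0 z0.
have d2 := sqr_ge0 d; have D2 := sqr_ge0 D.
have := mulr_ge0 K0 D2; have : d ^+ 2 <= K ^+ 2 * d ^+ 2 by rewrite ler_peMl.
by split; lra.
Qed.

(** Centring at the characteristic point absorbs the slopes into the symplectic term, and [dK4]
    becomes exactly the [E] of [cone_bilip]. *)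
Lemma graph_LipConst : exists2 K : RR, 1 <= K &
  forall (X : set 'rV[RR]_3) (a b c : RR),
  (forall q, X q -> hz q = a * hx q + b * hy q + c) ->
  (LipConst X dK (@deucl 4) <= K%:E)%E.
Proof.
have [K [f [K1 f0 fK]]] := snowflake RR.
have KK : 1 <= K ^+ 6 by rewrite exprn_ege1.
exists (32 * K ^+ 6); first by lra.
move=> X a b c XP.
(* [(2 b, - 2 a)] is the horizontal part of the characteristic point. *)
pose F q : 'rV[RR]_(3 + 1) := cone f (hx q - 2 * b) (hy q + 2 * a).
apply: (LipConst_le (X := X) (f := F)) => [|q q' /XP qz /XP qz']; first by lra.
have := cone_bilip K1 f0 fK (hx q - 2 * b) (hy q + 2 * a)
  (hx q' - 2 * b) (hy q' + 2 * a).
have -> // : dK4 q q' =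
  ((hx q - 2 * b - (hx q' - 2 * b)) ^+ 2
   + (hy q + 2 * a - (hy q' + 2 * a)) ^+ 2) ^+ 2
  + 4 * ((hx q - 2 * b) * (hy q' + 2 * a)
         - (hx q' - 2 * b) * (hy q + 2 * a)) ^+ 2.
by rewrite /dK4 qz qz'; field.
Qed.

Lemma plane_LipConst : exists2 K : RR, 1 <= K &
  forall P, is_plane P -> (LipConst P dK (@deucl 4) <= K%:E)%E.
Proof.
have [K K1 vertK] := vertical_LipConst; have [L L1 graphL] := graph_LipConst.
exists (K + L); first by lra.
move=> _ [p [u [w [free_uw ->]]]].
have coordE s t : let q := p + (s *: u + t *: w) in
    [/\ hx q = hx p + (s * hx u + t * hx w), hy q = hy p + (s * hy u + t * hy w)
      & hz q = hz p + (s * hz u + t * hz w)].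
  by rewrite /hx /hy /hz !mxE.
have [D0|DN0] := eqVneq (hx u * hy w - hy u * hx w) 0; last first.
  apply: (@le_trans _ _ L%:E); last by rewrite lee_fin; lra.
  set D := hx u * hy w - hy u * hx w in DN0.
  (* Cramer's rule for the slopes of the plane. *)
  pose a := (hz u * hy w - hz w * hy u) / D.
  pose b := (hx u * hz w - hx w * hz u) / D.
  apply: (graphL _ a b (hz p - a * hx p - b * hy p)) => _ [[s t] _ <-] /=.
  have [-> -> ->] := coordE s t; rewrite /a /b /D.
  by field.
apply: (@le_trans _ _ K%:E); last by rewrite lee_fin; lra.
(* The horizontal parts of [u] and [w] are parallel to a common nonzero direction [(a, b)],
   normalised below. *)
suff [a [b [al [be [abN0 [ux [uy [wx wy]]]]]]]] : exists a b al be : RR,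
    a ^+ 2 + b ^+ 2 != 0 /\ hx u = al * a /\ hy u = al * b /\
    hx w = be * a /\ hy w = be * b.
  pose n := Num.sqrt (a ^+ 2 + b ^+ 2).
  have nn : n ^+ 2 = a ^+ 2 + b ^+ 2 by rewrite sqr_sqrtr // addr_ge0 ?sqr_ge0.
  have n0 : n != 0 by rewrite -sqrf_eq0 nn.
  apply: (vertK _ (a / n) (b / n) (hx p) (hy p)).
    by rewrite !exprMn -mulrDl -nn -exprMn divff // expr1n.
  move=> _ [[s t] _ <-] /=; have [-> -> _] := coordE s t.
  exists ((s * al + t * be) * n); rewrite ux uy wx wy.
  by split; field.
have [u0|uN0] := eqVneq (hx u ^+ 2 + hy u ^+ 2) 0; last first.
  exists (hx u), (hy u), 1,
    ((hx u * hx w + hy u * hy w) / (hx u ^+ 2 + hy u ^+ 2)).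
  split=> //; rewrite !mul1r; split=> //; split=> //.
  move: uN0; set n := _ + _ => uN0; rewrite ![_ / n * _]mulrAC.
  split; apply: (canRL (mulfK uN0)); rewrite /n.
    transitivity ((hx u * hx w + hy u * hy w) * hx u
      - hy u * (hx u * hy w - hy u * hx w)); first by ring.
    by rewrite D0 mulr0 subr0.
  transitivity ((hx u * hx w + hy u * hy w) * hy u
    + hx u * (hx u * hy w - hy u * hx w)); first by ring.
  by rewrite D0 mulr0 addr0.
move/eqP: u0; rewrite paddr_eq0 ?sqr_ge0 // !sqrf_eq0 => /andP[/eqP ux /eqP uy].
have [w0|wN0] := eqVneq (hx w ^+ 2 + hy w ^+ 2) 0; last first.
  by exists (hx w), (hy w), 0, 1; rewrite !mul0r !mul1r.
move/eqP: w0; rewrite paddr_eq0 ?sqr_ge0 // !sqrf_eq0 => /andP[/eqP wx /eqP wy].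
have lin s t : let q := s *: u + t *: w in
    [/\ hx q = s * hx u + t * hx w, hy q = s * hy u + t * hy w
      & hz q = s * hz u + t * hz w].
  by rewrite /hx /hy /hz !mxE.
have zero : [/\ hx 0 = 0, hy 0 = 0 & hz 0 = 0] by rewrite /hx /hy /hz !mxE.
have [zx zy zz] := zero.
(* Both vectors are now vertical, so [hz w *: u - hz u *: w = 0] contradicts independence. *)
have [_ uz] : hz w = 0 /\ - hz u = 0.
  apply: free_uw; have [lx ly lz] := lin (hz w) (- hz u).
  apply: row3P; rewrite ?lx ?ly ?lz ?zx ?zy ?zz ?ux ?uy ?wx ?wy; ring.
have [/eqP] : (1 : RR) = 0 /\ (0 : RR) = 0.
  apply: free_uw; have [lx ly lz] := lin 1 0.
  apply: row3P; rewrite ?lx ?ly ?lz ?zx ?zy ?zz ?ux ?uy ?wx ?wy; first by ring.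
    by ring.
  by move/eqP: uz; rewrite oppr_eq0 => /eqP ->; ring.
by rewrite oner_eq0.
Qed.

Theorem theorem1p1 :
  exists L : RR, 1 < L /\
    (forall l : set 'rV[RR]_3, is_line l ->
       (LipConst l dK (@deucl 3) <= L%:E)%E) /\
    (forall P : set 'rV[RR]_3, is_plane P ->
       (LipConst P dK (@deucl 4) <= L%:E)%E).
Proof.
have [K K1 lineK] := line_LipConst; have [M M1 planeM] := plane_LipConst.
exists (K + M); split; first by lra.
by split=> [l /lineK|P /planeM] /le_trans; apply; rewrite lee_fin; lra.
Qed.
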